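(* Let $F$ be a field of characteristic not $2$, let $\Gamma$ be an additive abelian group with a skew-symmetric bicharacter $\epsilon:\Gamma\times\Gamma\to F^*$, let $A$ be a $\Gamma$-graded $(\epsilon,\Gamma)$-color-commutative associative $F$-algebra with an identity element, and let $D\subset \mathrm{Der}^\epsilon(A)$ be a nonzero $\Gamma$-graded color-commutative subspace. Then the $\Gamma$-graded associative algebra $A[D]$ is graded simple if and only if $A$ is $\Gamma$-graded $D$-simple.
   Context: A skew-symmetric bicharacter is a map $\epsilon:\Gamma\times\Gamma\to F^*$ with $\epsilon(\lambda,\mu)=\epsilon(\mu,\lambda)^{-1}$ and $\epsilon(\lambda,\mu+\nu)=\epsilon(\lambda,\mu)\epsilon(\lambda,\nu)$ for all $\lambda,\mu,\nu\in\Gamma$. For a nonzero homogeneous element $x$ of a $\Gamma$-graded space, $\bar x\in\Gamma$ denotes its degree (its ''color''), and $\epsilon(x,y):=\epsilon(\bar x,\bar y)$. For a $\Gamma$-graded space $B$, $H(B)$ is the set of homogeneous elements of $B$. $A=\bigoplus_{\lambda\in\Gamma}A_\lambda$ is $(\epsilon,\Gamma)$-color-commutative if $xy=\epsilon(x,y)yx$ for all $x,y\in H(A)$. A homogeneous color-derivation of degree $\bar\partial\in\Gamma$ is an $F$-linear map $\partial:A\to A$ with $\partial(a)\in A_{\bar\partial+\bar a}$ and $\partial(ab)=\partial(a)b+\epsilon(\partial,a)a\partial(b)$ for all $a,b\in H(A)$. $\mathrm{Der}^\epsilon_\lambda(A)$ is the $F$-space of homogeneous color-derivations of degree $\lambda$,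 and $\mathrm{Der}^\epsilon(A)=\bigoplus_{\lambda\in\Gamma}\mathrm{Der}^\epsilon_\lambda(A)$. A $\Gamma$-graded subspace $D\subset\mathrm{Der}^\epsilon(A)$ is color-commutative if $\partial\partial'=\epsilon(\partial,\partial')\partial'\partial$ (composition of operators) for all $\partial,\partial'\in H(D)$. $A[D]$ is the associative subalgebra of $\mathrm{End}_F(A)$ generated by $A$ (acting on $A$ by left multiplication) and $D$; it is $\Gamma$-graded by the degrees of operators. A $\Gamma$-graded associative algebra is graded simple if it has no nontrivial $\Gamma$-graded (two-sided) ideals. $A$ is ($\Gamma$-)graded $D$-simple if it has no nontrivial $\Gamma$-graded ideals that are $D$-stable (i.e. ideals $K$ with $\partial(K)\subset K$ for all $\partial\in D$); ''nontrivial'' means different from $0$ and from the whole algebra. *)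

(* Defs.v *)
From HB Require Import structures.
From mathcomp Require Import all_boot all_algebra.
From mathcomp Require Import boolp classical_sets.

Set Implicit Arguments.
Unset Strict Implicit.
Unset Printing Implicit Defensive.

Import GRing.Theory.
Local Open Scope classical_set_scope.
Local Open Scope ring_scope.

(* The algebra End_F(A); its product is composition of operators. *)
Definition endo (F : fieldType) (A : algType F) : Type := {linear A -> A}.

Identity Coercion endo_to_linear : endo >-> GRing.Linear.type.

Section EndoAlgebra.
Context (F : fieldType) (A : algType F).
Implicit Types f g h : endo A.

Lemma endoP f g : f =1 g -> f = g.
Proof.
case: f g => f cf [g cg] /= /funext fg; rewrite {}fg in cf *.
congr (GRing.Linear.Pack _).
case: cf => [[[h1 h2]] [h3]]; case: cg => [[[k1 k2]] [k3]].
by rewrite (Prop_irrelevance h1 k1) (Prop_irrelevance h2 k2)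
           (Prop_irrelevance h3 k3).
Qed.

HB.instance Definition _ := gen_eqMixin (endo A).
HB.instance Definition _ := gen_choiceMixin (endo A).

Let endo0 : endo A := \0.
Let endoN f : endo A := \- f.
Let endoD f g : endo A := f \+ g.
Let endo1 : endo A := idfun.
Let endoM f g : endo A := f \o g.
Let endoZ (c : F) f : endo A := c \*: f.

Let endoDA : associative endoD.
Proof. by move=> f g h; apply: endoP => x /=; rewrite addrA. Qed.
Let endoDC : commutative endoD.
Proof. by move=> f g; apply: endoP => x /=; rewrite addrC. Qed.
Let endo0D : left_id endo0 endoD.
Proof. by move=> f; apply: endoP => x /=; rewrite add0r. Qed.
Let endoND : left_inverse endo0 endoN endoD.
Proof. by move=> f; apply: endoP => x /=; rewrite addNr. Qed.

HB.instance Definition _ :=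
  GRing.isZmodule.Build (endo A) endoDA endoDC endo0D endoND.

Let endoMA : associative endoM.
Proof. by move=> f g h; apply: endoP. Qed.
Let endo1M : left_id endo1 endoM.
Proof. by move=> f; apply: endoP. Qed.
Let endoM1 : right_id endo1 endoM.
Proof. by move=> f; apply: endoP. Qed.
Let endoMDl : left_distributive endoM endoD.
Proof. by move=> f g h; apply: endoP. Qed.
Let endoMDr : right_distributive endoM endoD.
Proof. by move=> f g h; apply: endoP => x /=; rewrite raddfD. Qed.
Let endo1_neq0 : endo1 != 0.
Proof.
apply/eqP => /(congr1 (fun f : endo A => f 1)) /= /eqP.
by rewrite oner_eq0.
Qed.

HB.instance Definition _ := GRing.Zmodule_isNzRing.Build (endo A)
  endoMA endo1M endoM1 endoMDl endoMDr endo1_neq0.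

Let endoZA a b f : endoZ a (endoZ b f) = endoZ (a * b) f.
Proof. by apply: endoP => x /=; rewrite scalerA. Qed.
Let endo1Z : left_id 1 endoZ.
Proof. by move=> f; apply: endoP => x /=; rewrite scale1r. Qed.
Let endoZDr : right_distributive endoZ +%R.
Proof. by move=> a f g; apply: endoP => x /=; rewrite scalerDr. Qed.
Let endoZDl f : {morph endoZ^~ f : a b / a + b}.
Proof. by move=> a b; apply: endoP => x /=; rewrite scalerDl. Qed.

HB.instance Definition _ := GRing.Zmodule_isLmodule.Build F (endo A)
  endoZA endo1Z endoZDr endoZDl.

Let endoZAl (a : F) f g : a *: (f * g) = (a *: f) * g.
Proof. by apply: endoP. Qed.

HB.instance Definition _ :=
  GRing.Lmodule_isLalgebra.Build F (endo A) endoZAl.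

Let endoZAr (a : F) f g : a *: (f * g) = f * (a *: g).
Proof. by apply: endoP => x /=; rewrite linearZ. Qed.

HB.instance Definition _ :=
  GRing.Lalgebra_isAlgebra.Build F (endo A) endoZAr.

Lemma endo0E x : (0 : endo A) x = 0. Proof. by []. Qed.
Lemma endo1E x : (1 : endo A) x = x. Proof. by []. Qed.
Lemma endoNE f x : (- f) x = - f x. Proof. by []. Qed.
Lemma endoDE f g x : (f + g) x = f x + g x. Proof. by []. Qed.
Lemma endoME f g x : (f * g) x = f (g x). Proof. by []. Qed.
Lemma endoZE (c : F) f x : (c *: f) x = c *: f x. Proof. by []. Qed.

Definition lmul_endo (a : A) : endo A := a \*o idfun.

Lemma lmul_endoE a x : lmul_endo a x = a * x. Proof. by []. Qed.

End EndoAlgebra.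

Section GradedSpaces.
Context (F : fieldType) (G : zmodType) (V : lmodType F).
Implicit Types S : set V.

Definition subspace S :=
  S 0 /\ forall (c : F) u v, S u -> S v -> S (c *: u + v).

Definition component_sum (V_ : G -> set V) : set V :=
  [set v | exists (s : seq G) (f : G -> V),
     [/\ uniq s, forall l, l \in s -> V_ l (f l) & v = \sum_(l <- s) f l]].

Definition independent_components (V_ : G -> set V) :=
  forall (s : seq G) (f : G -> V), uniq s ->
    (forall l, l \in s -> V_ l (f l)) ->
    \sum_(l <- s) f l = 0 -> forall l, l \in s -> f l = 0.

Definition graded_space (V_ : G -> set V) :=
  [/\ forall l, subspace (V_ l),
      component_sum V_ = [set: V] & independent_components V_].

(* V_ need only grade a subspace containing S. *)
Definition graded_subspace (V_ : G -> set V) S :=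
  subspace S /\ S `<=` component_sum (fun l => S `&` V_ l).

End GradedSpaces.

Section GradedAlgebras.
Context (F : fieldType) (G : zmodType) (E : algType F).
Implicit Types B I : set E.

Definition graded_algebra (E_ : G -> set E) :=
  graded_space E_ /\
  forall l m a b, E_ l a -> E_ m b -> E_ (l + m) (a * b).

Definition subalgebra B :=
  subspace B /\ forall a b, B a -> B b -> B (a * b).

(* I is a two-sided ideal of the subalgebra B. *)
Definition ideal_of B I :=
  [/\ I `<=` B, subspace I &
      forall b x, B b -> I x -> I (b * x) /\ I (x * b)].

(* Here B is a subalgebra of E, with homogeneous components B `&` E_ l. *)
Definition graded_simple (E_ : G -> set E) B :=
  forall I, ideal_of B I -> graded_subspace (fun l => B `&` E_ l) I ->
    I = [set 0] \/ I = B.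

End GradedAlgebras.

Definition skew_bicharacter (F : fieldType) (G : zmodType)
    (eps : G -> G -> F) :=
  [/\ forall l m, eps l m != 0,
      forall l m, eps l m = (eps m l)^-1 &
      forall l m n, eps l (m + n) = eps l m * eps l n].

Section ColorAlgebras.
Context (F : fieldType) (G : zmodType) (eps : G -> G -> F).
Context (A : algType F) (A_ : G -> set A).

Definition color_commutative :=
  forall l m a b, A_ l a -> A_ m b -> a * b = eps l m *: (b * a).

Definition endo_deg (l : G) : set (endo A) :=
  [set f | forall m a, A_ m a -> A_ (l + m) (f a)].

Definition color_der_deg (l : G) : set (endo A) :=
  [set d | endo_deg l d /\
     forall m n a b, A_ m a -> A_ n b ->
       d (a * b) = d a * b + eps l m *: (a * d b)].

Definition color_der : set (endo A) := component_sum color_der_deg.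

Definition color_commutative_ops (D : set (endo A)) :=
  forall l m d d', D d -> color_der_deg l d -> D d' -> color_der_deg m d' ->
    d * d' = eps l m *: (d' * d).

Definition graded_D_simple (D : set (endo A)) :=
  forall K : set A, ideal_of [set: A] K -> graded_subspace A_ K ->
    (forall d a, D d -> K a -> K (d a)) ->
    K = [set 0] \/ K = [set: A].

(* The algebra A[D], where A acts on itself by left multiplication. *)
Definition weyl_alg (D : set (endo A)) : set (endo A) :=
  smallest (@subalgebra F (endo A)) (range (@lmul_endo F A) `|` D).

End ColorAlgebras.

(* Main.v *)
Require Import Defs.
From HB Require Import structures.
From mathcomp Require Import all_boot all_algebra.
From mathcomp Require Import boolp classical_sets.

Set Implicit Arguments.
Unset Strict Implicit.
Unset Printing Implicit Defensive.

Import GRing.Theory.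
Local Open Scope classical_set_scope.
Local Open Scope ring_scope.

(** Why the theorem holds.  In both directions, ideals of [A[D]] and ideals of
    [A] are compared through the action of [A[D]] on [A].

    If [K] is a graded [D]-stable ideal of [A], the operators of [A[D]] that
    map [A] into [K] form a graded two-sided ideal [I] of [A[D]], and
    multiplication by [a] is in [I] exactly when [a] is in [K].  So [I] is
    nontrivial when [K] is ([graded_simple_weyl_D_simple]).

    Conversely, let [I] be a nonzero graded ideal of [A[D]].  The elements [a]
    whose multiplication operator is in [I] form a graded ideal [K] of [A]; it
    is [D]-stable, since the color bracket of [d] with multiplication by [a] is
    multiplication by [d a].  If [K] is all of [A], then 1 is in [I] and [I] is
    [A[D]], so the point is that [K] is not zero.  Left multiplications and
    color derivations are color versions of Grothendieck's differential
    operators, of order at most 0 and 1.  By the color Leibniz rule, composition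
    adds orders ([color_diff_op_mul]), so each homogeneous element of [A[D]] has
    finite order ([weyl_alg_components]).  Take a nonzero homogeneous [w] in [I]
    and bracket it with homogeneous elements of [A] while the result is nonzero.
    Brackets stay in [I] and lower the order, so this stops at a nonzero [w']
    in [I] that color commutes with [A]; then [w'] is multiplication by [w' 1],
    because [w' a = w' (a * 1)] and [A] is color commutative
    ([color_centralizer_lmul], [bracket_closed_lmul]). *)

(** * Sums of homogeneous components *)

Section Subspaces.
Context (F : fieldType) (G : zmodType) (V : lmodType F).
Implicit Types S : set V.

Lemma subspaceD S u v : subspace S -> S u -> S v -> S (u + v).
Proof. by case=> _ SP Su Sv; rewrite -[u]scale1r; apply: SP. Qed.

Lemma subspaceZ S c u : subspace S -> S u -> S (c *: u).
Proof. by case=> S0 SP Su; rewrite -[_ *: _]addr0; apply: SP. Qed.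

Lemma subspaceB S u v : subspace S -> S u -> S v -> S (u - v).
Proof.
move=> SS Su Sv; apply: subspaceD => //.
by rewrite -scaleN1r; apply: subspaceZ.
Qed.

Lemma subspace_sum S (I : eqType) (r : seq I) (f : I -> V) :
  subspace S -> (forall i, i \in r -> S (f i)) -> S (\sum_(i <- r) f i).
Proof.
move=> SS Sf; rewrite big_seq; apply: big_ind => //; first by case: SS.
by move=> u v; apply: subspaceD.
Qed.

Lemma subspace0 : subspace [set (0 : V)].
Proof. by split=> // c u v -> ->; rewrite scaler0 addr0. Qed.

Lemma component_sum_ind (V_ : G -> set V) S :
  subspace S -> (forall l, V_ l `<=` S) -> component_sum V_ `<=` S.
Proof.
move=> SS VS _ [s [f [_ Vf ->]]].
by apply: subspace_sum => // l /Vf; apply: VS.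
Qed.

Lemma component_sum_homogeneous (V_ : G -> set V) l v :
  V_ l v -> component_sum V_ v.
Proof.
move=> Vv; exists [:: l], (fun=> v); split=> //; last by rewrite big_seq1.
by move=> m; rewrite inE => /eqP ->.
Qed.

Lemma component_sumS (V_ S_ : G -> set V) :
  (forall l, V_ l `<=` S_ l) -> component_sum V_ `<=` component_sum S_.
Proof. by move=> VS v [s [f [us Vf ->]]]; exists s, f; split=> // l /Vf/VS. Qed.

(** Padding a family by zero makes its index list irrelevant, so that two
    decompositions can be compared over one list. *)
Lemma component_sum_total (V_ : G -> set V) v :
    (forall l, V_ l 0) -> component_sum V_ v ->
  exists (s : seq G) (f : G -> V), [/\ uniq s, forall l, V_ l (f l),
    forall l, l \notin s -> f l = 0 & v = \sum_(l <- s) f l].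
Proof.
move=> V0 [s [f [us Vf ->]]].
exists s, (fun l => if l \in s then f l else 0); split=> //.
- by move=> l; case: ifP => // /Vf.
- by move=> l /negPf ->.
- by apply: eq_big_seq => l ->.
Qed.

Lemma sum_widen (s t : seq G) (f : G -> V) : uniq s -> uniq t ->
  {subset s <= t} -> (forall l, l \notin s -> f l = 0) ->
  \sum_(l <- s) f l = \sum_(l <- t) f l.
Proof.
move=> us ut st f0.
have /(perm_big _) -> : perm_eq s [seq l <- t | l \in s].
  apply: uniq_perm => //; first exact: filter_uniq.
  move=> l; rewrite mem_filter; case ls: (l \in s) => //=.
  by rewrite st.
rewrite big_filter big_mkcond; apply: eq_bigr => l _.
by case: ifPn => // /f0.
Qed.

Lemma component_sum_subspace (V_ : G -> set V) :
  (forall l, subspace (V_ l)) -> subspace (component_sum V_).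
Proof.
move=> SV; have V0 l : V_ l 0 by case: (SV l).
split; first exact: (@component_sum_homogeneous _ 0).
move=> c u v /(component_sum_total V0)[s [f [us Vf f0 ->]]].
move=> /(component_sum_total V0)[t [g [ut Vg g0 ->]]].
pose r := undup (s ++ t); have ur : uniq r by rewrite undup_uniq.
exists r, (fun l => c *: f l + g l); split=> // [l _|].
  by apply: subspaceD => //; apply: subspaceZ.
rewrite big_split /= -scaler_sumr; congr (_ *: _ + _); apply: sum_widen => //.
  by move=> l ls; rewrite mem_undup mem_cat ls.
by move=> l lt; rewrite mem_undup mem_cat lt orbT.
Qed.

(** The summands of a decomposition are determined by the sum; hence a summand
    lies wherever some decomposition of the same vector puts its component. *)
Lemma component_mem (V_ S_ : G -> set V) (s : seq G) (f : G -> V) :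
    (forall l, subspace (V_ l)) -> independent_components V_ ->
    (forall l, S_ l `<=` V_ l) -> (forall l, S_ l 0) ->
    uniq s -> (forall l, l \in s -> V_ l (f l)) ->
    component_sum S_ (\sum_(l <- s) f l) -> forall l, l \in s -> S_ l (f l).
Proof.
move=> SV indV SV_ S0 us Vf.
move=> /(component_sum_total S0)[t [g [ut Sg g0 efg]]] l ls.
have V0 j : V_ j 0 by case: (SV j).
pose f' j := if j \in s then f j else 0.
have Vf' j : V_ j (f' j) by rewrite /f'; case: ifP => // /Vf.
pose r := undup (s ++ t); have ur : uniq r by rewrite undup_uniq.
have es : \sum_(j <- s) f j = \sum_(j <- r) f' j.
  rewrite -(@sum_widen s) //.
    by apply: eq_big_seq => j js; rewrite /f' js.
    by move=> j js; rewrite mem_undup mem_cat js.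
  by move=> j /negPf js; rewrite /f' js.
have et : \sum_(j <- t) g j = \sum_(j <- r) g j.
  by apply: sum_widen => // j jt; rewrite mem_undup mem_cat jt orbT.
have /(_ l) : forall j, j \in r -> f' j - g j = 0.
  apply: (indV r (fun j => f' j - g j)) => // [j _|].
    by apply: subspaceB => //; apply: SV_.
  by rewrite sumrB -es -et efg subrr.
rewrite mem_undup mem_cat ls => /(_ isT)/subr0_eq; rewrite /f' ls => ->.
exact: Sg.
Qed.

Lemma homogeneous_mem (V_ S_ : G -> set V) l v :
    (forall l, subspace (V_ l)) -> independent_components V_ ->
    (forall l, S_ l `<=` V_ l) -> (forall l, S_ l 0) ->
  V_ l v -> component_sum S_ v -> S_ l v.
Proof.
move=> SV indV SV_ S0 Vv Sv.
apply: (@component_mem V_ S_ [:: l] (fun=> v)) => //; last exact: mem_head.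
  by move=> j; rewrite inE => /eqP ->.
by rewrite big_seq1.
Qed.

(** The shift by [m] is what a sum of operators of distinct degrees produces
    when it is applied to an element of degree [m]. *)
Lemma graded_subspace_component (V_ : G -> set V) S m (s : seq G) (f : G -> V) :
    graded_space V_ -> graded_subspace V_ S -> uniq s ->
    (forall l, l \in s -> V_ (l + m) (f l)) ->
    S (\sum_(l <- s) f l) -> forall l, l \in s -> S (f l).
Proof.
move=> [SV _ indV] [SS grS] us Vf Sf l ls.
pose g j := f (j - m); pose t := [seq j + m | j <- s].
have ut : uniq t by rewrite map_inj_uniq //; apply: addIr.
have Vg j : j \in t -> V_ j (g j).
  by move=> /mapP[k ks ->]; rewrite /g addrK; apply: Vf.
have egf : \sum_(j <- t) g j = \sum_(j <- s) f j.
  by rewrite big_map; apply: eq_bigr => j _; rewrite /g addrK.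
have := @component_mem V_ (fun j => S `&` V_ j) t g SV indV.
case/(_ (fun j => @subIsetr _ S (V_ j)) _ ut Vg _ (l + m)).
- by move=> j; split; [case: SS | case: (SV j)].
- by rewrite egf; apply: grS.
- exact: map_f.
by rewrite /g addrK.
Qed.

(** Makes independence of the components, also after a shift, an instance of
    [graded_subspace_component]. *)
Lemma graded_subspace0 (V_ : G -> set V) :
  graded_space V_ -> graded_subspace V_ [set 0].
Proof.
move=> [SV _ _]; split; first exact: subspace0.
move=> _ ->; apply: (@component_sum_homogeneous _ 0).
by split=> //; case: (SV 0).
Qed.

End Subspaces.

(** * Graded algebras and their homogeneous operators *)

Section GradedAlgebra.
Context (F : fieldType) (G : zmodType) (A : algType F) (A_ : G -> set A).

Lemma component_sum_subalgebra :
  (forall l, subspace (A_ l)) ->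
  (forall l m a b, A_ l a -> A_ m b -> A_ (l + m) (a * b)) ->
  subalgebra (component_sum A_).
Proof.
move=> SA mulA; have SS := component_sum_subspace SA.
split=> // u v [s [f [_ Af ->]]] [t [g [_ Ag ->]]].
rewrite mulr_suml; apply: subspace_sum => // l ls.
rewrite mulr_sumr; apply: subspace_sum => // m mt.
by apply: (@component_sum_homogeneous _ _ _ _ (l + m)); apply: mulA; auto.
Qed.

Hypothesis A_graded : graded_algebra A_.

Let SA l : subspace (A_ l). Proof. by case: A_graded => [[]]. Qed.
Let mulA l m a b : A_ l a -> A_ m b -> A_ (l + m) (a * b).
Proof. by case: A_graded => _; apply. Qed.

Lemma graded_ind S : subspace S -> (forall l, A_ l `<=` S) -> forall a, S a.
Proof.
move=> SS AS a; apply: (component_sum_ind SS AS).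
by case: A_graded => [[_ -> _]].
Qed.

Lemma endo_ext (f g : endo A) : (forall l a, A_ l a -> f a = g a) -> f = g.
Proof.
move=> fg; apply: endoP.
apply: (@graded_ind [set a | f a = g a]) => /=; last exact: fg.
split=> /=; first by rewrite !linear0.
by move=> c u v /= fu fv; rewrite !linearP fu fv.
Qed.

(** The degree-zero component of 1 fixes every homogeneous element by
    uniqueness of components, so it is a left identity, that is, 1. *)
Lemma graded_one : A_ 0 1.
Proof.
have A0 l : A_ l 0 by case: (SA l).
have [s [e [us Ae e0 e1]]] : exists (s : seq G) (f : G -> A), [/\ uniq s,
    forall l, A_ l (f l), forall l, l \notin s -> f l = 0 &
    1 = \sum_(l <- s) f l].
  by apply: component_sum_total => //; case: A_graded => [[_ -> _]].
suff -> : 1 = e 0 by [].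
suff /(congr1 (fun f : endo A => f 1)) : lmul_endo (e 0) = 1.
  by rewrite lmul_endoE endo1E mulr1.
apply: endo_ext => m b Ab; rewrite lmul_endoE endo1E; apply: subr0_eq.
(* [0] may be missing from [s], in which case [e 0 = 0]. *)
pose t := undup (0 :: s); have ut : uniq t by rewrite undup_uniq.
pose f l := e l * b - (if l == 0 then b else 0).
have -> : e 0 * b - b = f 0 by rewrite /f eqxx.
have [grA _] := A_graded.
apply: (graded_subspace_component (m := m) grA (graded_subspace0 grA) ut) => /=.
- move=> l _; apply: subspaceB => //; first exact: mulA.
  by case: eqP => // ->; rewrite add0r.
- rewrite sumrB -mulr_suml -(@sum_widen _ _ _ s) // -?e1; last first.
    by move=> l ls; rewrite mem_undup inE ls orbT.
  rewrite -big_mkcond -big_filter filter_pred1_uniq ?big_seq1 ?mul1r ?subrr //.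
  by rewrite mem_undup mem_head.
- by rewrite mem_undup mem_head.
Qed.

Lemma endo_sumE (I : Type) (r : seq I) (f : I -> endo A) a :
  (\sum_(i <- r) f i) a = \sum_(i <- r) f i a.
Proof. by elim/big_rec2: _ => // i x y _ <-. Qed.

Lemma endo_deg_subspace l : subspace (endo_deg A_ l).
Proof.
split=> [m a _|c u v du dv m a Aa]; first by rewrite endo0E; case: (SA (l + m)).
by rewrite endoDE endoZE; case: (SA (l + m)) => _; apply; auto.
Qed.

Lemma endo_deg_mul l m (f g : endo A) :
  endo_deg A_ l f -> endo_deg A_ m g -> endo_deg A_ (l + m) (f * g).
Proof. by move=> df dg k a Aa; rewrite endoME -addrA; apply/df/dg. Qed.

Lemma endo_deg_lmul l a : A_ l a -> endo_deg A_ l (lmul_endo a).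
Proof. by move=> Aa m b Ab; rewrite lmul_endoE; apply: mulA. Qed.

Lemma endo_deg_independent : independent_components (endo_deg A_).
Proof.
move=> s f us df sf0 l ls; apply: endo_ext => m a Aa; rewrite endo0E.
have [grA _] := A_graded.
apply: (@graded_subspace_component _ _ _ _ _ m s (fun j => f j a) grA
  (graded_subspace0 grA) us) => //= [j js|]; first exact: df.
by rewrite -endo_sumE sf0.
Qed.

Lemma lmul_endoM (a b : A) : lmul_endo (a * b) = lmul_endo a * lmul_endo b.
Proof. by apply: endoP => x; rewrite endoME !lmul_endoE mulrA. Qed.

Lemma lmul_endoP c (a b : A) :
  lmul_endo (c *: a + b) = c *: lmul_endo a + lmul_endo b.
Proof.
by apply: endoP => x; rewrite endoDE endoZE !lmul_endoE mulrDl scalerAl.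
Qed.

Lemma lmul_endo0 : lmul_endo (0 : A) = 0.
Proof. by apply: endoP => x; rewrite lmul_endoE mul0r. Qed.

Lemma lmul_endo1 : lmul_endo (1 : A) = 1.
Proof. by apply: endoP => x; rewrite lmul_endoE mul1r. Qed.

Lemma lmul_endo_inj : injective (@lmul_endo F A).
Proof.
by move=> a b /(congr1 (fun f : endo A => f 1)); rewrite !lmul_endoE !mulr1.
Qed.

(** A homogeneous component [f_l] of a multiplication [lmul_endo a] has
    [f_l b] and [f_l 1 * b] as the same component of [a * b]. *)
Lemma lmul_endo_component (a : A) (s : seq G) (f : G -> endo A) : uniq s ->
    (forall l, l \in s -> endo_deg A_ l (f l)) ->
    lmul_endo a = \sum_(l <- s) f l ->
  forall l, l \in s -> f l = lmul_endo (f l 1).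
Proof.
move=> us df ea l ls; apply: endo_ext => m b Ab.
rewrite lmul_endoE; apply: subr0_eq.
have [grA _] := A_graded.
apply: (@graded_subspace_component _ _ _ _ _ m s (fun j => f j b - f j 1 * b)
  grA (graded_subspace0 grA) us) => //= [j js|].
  apply: subspaceB => //; first exact: df.
  by apply: mulA => //; have := df j js 0 1 graded_one; rewrite addr0.
by rewrite sumrB -mulr_suml -!endo_sumE -ea !lmul_endoE mulr1 subrr.
Qed.

End GradedAlgebra.

(** * Color differential operators *)

Section ColorDifferentialOperators.
Context (F : fieldType) (G : zmodType) (eps : G -> G -> F).
Context (A : algType F) (A_ : G -> set A).
Hypotheses (eps_bichar : skew_bicharacter eps) (A_graded : graded_algebra A_).
Hypothesis A_comm : color_commutative eps A_.

Definition color_bracket l m (w : endo A) (a : A) : endo A :=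
  w * lmul_endo a - eps l m *: (lmul_endo a * w).

(** Grothendieck's differential operators of degree [l] and order less than
    [n], with commutators replaced by color commutators. *)
Fixpoint color_diff_op n (l : G) (w : endo A) : Prop :=
  if n is n'.+1 then endo_deg A_ l w /\
    forall m a, A_ m a -> color_diff_op n' (l + m) (color_bracket l m w a)
  else w = 0.

Lemma bicharDl l m n : eps (l + m) n = eps l n * eps m n.
Proof.
have [_ skew add] := eps_bichar.
by rewrite skew add invfM -!skew.
Qed.

Lemma color_bracketP l m c v w a : color_bracket l m (c *: v + w) a =
  c *: color_bracket l m v a + color_bracket l m w a.
Proof.
rewrite /color_bracket mulrDl mulrDr -scalerAl -scalerAr scalerBr !scalerDr.
by rewrite !scalerA [c * _]mulrC opprD addrACA.
Qed.

Lemma color_bracket0 l m a : color_bracket l m 0 a = 0.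
Proof. by rewrite /color_bracket mul0r mulr0 scaler0 subrr. Qed.

(** The color Leibniz rule: bracketing with [a] is a color derivation. *)
Lemma color_bracketM l m k (v w : endo A) a :
  color_bracket (l + m) k (v * w) a =
    eps m k *: (color_bracket l k v a * w) + v * color_bracket m k w a.
Proof.
rewrite /color_bracket mulrBl mulrBr scalerBr -!scalerAl -!scalerAr !scalerA.
rewrite bicharDl [eps l k * _]mulrC -!mulrA.
by rewrite addrC [RHS]addrC addrA subrK addrC.
Qed.

Lemma color_diff_op_subspace n l : subspace (color_diff_op n l).
Proof.
elim: n l => [|n IHn] l; first exact: subspace0.
have dS := endo_deg_subspace A_graded l.
split=> [|c u v [du Bu] [dv Bv]]; split.
- by case: dS.
- by move=> m a _; rewrite color_bracket0; case: (IHn (l + m)).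
- by case: dS => _; apply.
- move=> m a Aa; rewrite color_bracketP.
  by case: (IHn (l + m)) => _ SP; apply: SP; [apply: Bu | apply: Bv].
Qed.

Lemma color_diff_op_deg n l w : color_diff_op n l w -> endo_deg A_ l w.
Proof.
case: n => [->|n [] //]; by case: (endo_deg_subspace A_graded l).
Qed.

Lemma color_diff_opW n p l w : (n <= p)%N ->
  color_diff_op n l w -> color_diff_op p l w.
Proof.
elim: n p l w => [p l w _ ->|n IHn [//|p] l w np [dw Bw]].
  by case: (color_diff_op_subspace p l).
by split=> // m a Aa; apply: IHn => //; apply: Bw.
Qed.

(** Since the index is a strict bound on the order, [n + p] leaves one unit to
    spare; this form also covers the zero operator at index 0. *)
Lemma color_diff_op_mul n p l m v w : color_diff_op n l v ->
  color_diff_op p m w -> color_diff_op (n + p) (l + m) (v * w).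
Proof.
have op0 k j : color_diff_op k j 0 by case: (color_diff_op_subspace k j).
elim: {n p}(n + p)%N {-2}n {-2}p (leqnn (n + p)) l m v w => [|k IHk] n p.
  by rewrite leqn0 addn_eq0 => /andP[/eqP-> /eqP->] l m v w -> _; rewrite mul0r.
case: n => [_ l m v w -> _|n]; first by rewrite mul0r.
case: p => [_ l m v w _ ->|p]; first by rewrite mulr0.
rewrite addSn ltnS => npk l m v w ov ow; split.
  by apply: endo_deg_mul; [case: ov | case: ow].
move=> j a Aa; rewrite color_bracketM.
case: (color_diff_op_subspace (n + p.+1) (l + m + j)) => _; apply.
  by rewrite addrAC; apply: IHk => //; case: ov => _; apply.
rewrite -addrA addnS -addSn; apply: IHk; rewrite ?addSnnS //.
by case: ow => _; apply.
Qed.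

Lemma color_diff_op_lmul l a : A_ l a -> color_diff_op 1 l (lmul_endo a).
Proof.
move=> Aa; split; first exact: endo_deg_lmul.
move=> m b Ab /=; rewrite /color_bracket -!lmul_endoM (A_comm Aa Ab).
by rewrite -[eps l m *: (b * a)]addr0 lmul_endoP lmul_endo0 addr0 subrr.
Qed.

Lemma color_bracket_der l m d a :
  color_der_deg eps A_ l d -> A_ m a -> color_bracket l m d a = lmul_endo (d a).
Proof.
move=> [dd der] Aa; apply: (endo_ext A_graded) => k b Ab.
rewrite /color_bracket endoDE endoNE endoZE !endoME !lmul_endoE.
by rewrite (der m k) // addrK.
Qed.

Lemma color_diff_op_der l d : color_der_deg eps A_ l d -> color_diff_op 2 l d.
Proof.
move=> dd; have [deg_d _] := dd; split=> // m a Aa.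
rewrite color_bracket_der //; apply: color_diff_op_lmul; exact: deg_d.
Qed.

(** An operator that color commutes with [A] is determined by its value at 1:
    [w a = w (a 1)] equals [a * w 1] up to the color factor, i.e. [w 1 * a]. *)
Lemma color_centralizer_lmul l w : endo_deg A_ l w ->
    (forall m a, A_ m a -> color_bracket l m w a = 0) ->
  w = lmul_endo (w 1).
Proof.
move=> dw Bw; apply: (endo_ext A_graded) => m a Aa.
have /(congr1 (fun f : endo A => f 1)) := Bw m a Aa.
rewrite /color_bracket endoDE endoNE endoZE !endoME !lmul_endoE endo0E mulr1.
move/subr0_eq => ->.
have Aw : A_ l (w 1) by have := dw 0 1 (graded_one A_graded); rewrite addr0.
by rewrite (A_comm Aw Aa).
Qed.

(** The order drops with every bracket, so bracketing a nonzero operator with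
    [A] as long as possible ends at a nonzero multiplication. *)
Lemma bracket_closed_lmul (I : set (endo A)) n l w :
    (forall l m v a, A_ m a -> I v -> I (color_bracket l m v a)) ->
    color_diff_op n l w -> I w -> w <> 0 ->
  exists2 a, a <> 0 & I (lmul_endo a).
Proof.
move=> BI; elim: n l w => [//|n IHn] l w [dw Bw] Iw w0.
have [[m [a [Aa Ba]]]|noB] :=
  pselect (exists m a, A_ m a /\ color_bracket l m w a <> 0).
  by apply: (IHn _ _ (Bw m a Aa)) => //; apply: BI.
have ew : w = lmul_endo (w 1).
  apply: (color_centralizer_lmul dw) => m a Aa.
  by apply: contrapT => Ba; apply: noB; exists m, a.
exists (w 1); last by rewrite -ew.
by move=> w10; apply: w0; rewrite ew w10 lmul_endo0.
Qed.

(** * Ideals of the algebra generated by A and D *)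

Section WeylAlgebra.
Variable D : set (endo A).
Hypothesis D_graded : graded_subspace (color_der_deg eps A_) D.

Lemma weyl_alg_subalgebra : subalgebra (weyl_alg D).
Proof.
split; first split.
- by move=> B [[[]]].
- by move=> c u v Wu Wv B BP; case: (BP) => [[[_ SB] _] _]; apply: SB;
    [apply: Wu | apply: Wv].
- by move=> u v Wu Wv B BP; case: (BP) => [[_ MB] _]; apply: MB;
    [apply: Wu | apply: Wv].
Qed.

Lemma weyl_alg_lmul a : weyl_alg D (lmul_endo a).
Proof. by move=> B [_ gB]; apply: gB; left; exists a. Qed.

Lemma weyl_alg_der d : D d -> weyl_alg D d.
Proof. by move=> Dd B [_ gB]; apply: gB; right. Qed.

Lemma weyl_alg_ind (B : set (endo A)) :
    subalgebra B -> (forall a, B (lmul_endo a)) -> D `<=` B ->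
  weyl_alg D `<=` B.
Proof.
move=> SB lB DB; apply: smallest_sub => //.
by move=> w [[a _ <-]|/DB].
Qed.

(** Operators of finite order form a graded subalgebra containing the
    generators; so [A[D]] is graded, and consists of such operators. *)
Lemma weyl_alg_components : weyl_alg D `<=` component_sum
  (fun l => [set w | weyl_alg D w /\ exists n, color_diff_op n l w]).
Proof.
have [WS WM] := weyl_alg_subalgebra.
set W_ := fun _ => _.
have SW l : subspace (W_ l).
  split=> [|c u v [Wu [n ou]] [Wv [p ov]]]; split.
  - by case: WS.
  - by exists 0.
  - by case: WS => _; apply.
  - exists (maxn n p); case: (color_diff_op_subspace (maxn n p) l) => _; apply.
      exact: (color_diff_opW (leq_maxl n p)).
    exact: (color_diff_opW (leq_maxr n p)).
have WB : subalgebra (component_sum W_).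
  apply: component_sum_subalgebra => // l m u v [Wu [n ou]] [Wv [p ov]].
  by split; [apply: WM | exists (n + p)%N; apply: color_diff_op_mul].
have SB := WB.1.
apply: weyl_alg_ind => //.
- apply: (@graded_ind _ _ _ _ A_graded
    (fun a => component_sum W_ (lmul_endo a))).
    split; first by rewrite lmul_endo0; case: SB.
    by move=> c a b Ba Bb; rewrite lmul_endoP; case: SB => _; apply.
  move=> l a Aa; apply: (@component_sum_homogeneous _ _ _ _ l).
  by split; [exact: weyl_alg_lmul | exists 1%N; apply: color_diff_op_lmul].
- case: D_graded => _ /subset_trans; apply.
  apply: component_sumS => l d [Dd dd].
  by split; [exact: weyl_alg_der | exists 2%N; apply: color_diff_op_der].
Qed.

(** For a [D]-stable ideal [K], the operators with values in [K] form a graded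
    ideal of [A[D]] whose multiplications are those by elements of [K]. *)
Lemma graded_simple_weyl_D_simple :
  graded_simple (endo_deg A_) (weyl_alg D) -> graded_D_simple A_ D.
Proof.
move=> simpleW K [_ SK idK] grK DK.
have [WS WM] := weyl_alg_subalgebra.
have WK w a : weyl_alg D w -> K a -> K (w a).
  move=> Ww.
  have /(_ w Ww) : weyl_alg D `<=` [set w | forall a, K a -> K (w a)].
    apply: weyl_alg_ind; last by move=> d Dd b; apply: DK.
      split; first split=> [b _|c u v Ku Kv b Kb].
      - by rewrite endo0E; case: SK.
      - by rewrite endoDE endoZE; case: SK => _; apply; auto.
      - by move=> u v Ku Kv b Kb; rewrite endoME; auto.
    by move=> b x Kx; rewrite lmul_endoE; case: (idK b x).
  exact.
pose I : set (endo A) := [set w | weyl_alg D w /\ forall a, K (w a)].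
have SI : subspace I.
  split=> [|c u v [Wu Ku] [Wv Kv]]; split.
  - by case: WS.
  - by move=> a; rewrite endo0E; case: SK.
  - by case: WS => _; apply.
  - by move=> a; rewrite endoDE endoZE; case: SK => _; apply.
have idI : ideal_of (weyl_alg D) I.
  split=> // [w []//|b w Wb [Ww Kw]]; split; split.
  - exact: WM.
  - by move=> a; rewrite endoME; apply: WK.
  - exact: WM.
  - by move=> a; rewrite endoME; apply: Kw.
have grI : graded_subspace (fun l => weyl_alg D `&` endo_deg A_ l) I.
  split=> // w [/weyl_alg_components[s [f [us Wf ew]]] Kw].
  exists s, f; split=> // l ls; have [Wfl [n ofl]] := Wf l ls.
  split; last by split=> //; apply: color_diff_op_deg ofl.
  split=> //; apply: (graded_ind A_graded).
    split=> [|c u v Ku Kv]; first by rewrite linear0; case: SK.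
    by rewrite linearP; case: SK => _; apply.
  move=> m a Aa; apply: (@graded_subspace_component _ _ _ A_ K m s
    (fun j => f j a) A_graded.1 grK us) => // [j js|].
    by have [_ [k /color_diff_op_deg dfj]] := Wf j js; apply: dfj.
  by rewrite -endo_sumE -ew.
have lmulI a : K a -> I (lmul_endo a).
  move=> Ka; split; first exact: weyl_alg_lmul.
  by move=> b; rewrite lmul_endoE; case: (idK b a).
have [I0|IW] := simpleW I idI grI; [left|right].
  apply/seteqP; split=> [a /lmulI|_ ->]; last by case: SK.
  by rewrite I0 => /= la0; apply: lmul_endo_inj; rewrite lmul_endo0.
apply/seteqP; split=> // a _.
have [_ /(_ 1)] : I (lmul_endo a) by rewrite IW; apply: weyl_alg_lmul.
by rewrite lmul_endoE mulr1.
Qed.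

(** The multiplications lying in a graded ideal [I] of [A[D]] are those by the
    elements of a graded ideal of [A], which is [D]-stable because the
    multiplication by [d a] is the bracket of [d] with [a]. *)
Lemma D_simple_graded_simple_weyl :
  graded_D_simple A_ D -> graded_simple (endo_deg A_) (weyl_alg D).
Proof.
move=> simpleA I [IW SI idI] [_ grI].
have [WS WM] := weyl_alg_subalgebra.
have BI l m v a : weyl_alg D v -> I (lmul_endo a) -> I (color_bracket l m v a).
  move=> Wv Ia; apply: subspaceB => //; first by case: (idI v _ Wv Ia).
  by apply: subspaceZ => //; case: (idI v _ Wv Ia).
pose K : set A := [set a | I (lmul_endo a)].
have SK : subspace K.
  split=> [|c u v Iu Iv]; rewrite /K /= ?lmul_endo0 ?lmul_endoP.
    by case: SI.
  by case: SI => _; apply.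
have idK : ideal_of [set: A] K.
  split=> // b x _ Ix; rewrite /K /= !lmul_endoM.
  by apply: idI => //; apply: weyl_alg_lmul.
have grK : graded_subspace A_ K.
  split=> // a /grI[s [f [us If ea]]].
  have df l : l \in s -> endo_deg A_ l (f l) by move=> /If[_ []].
  exists s, (fun l => f l 1); split=> // [l ls|]; last first.
    by rewrite -endo_sumE -ea lmul_endoE mulr1.
  split; last first.
    by have := df l ls 0 1 (graded_one A_graded); rewrite addr0.
  by rewrite /K /= -(lmul_endo_component A_graded us df ea ls); case: (If l ls).
have DK d a : D d -> K a -> K (d a).
  move=> Dd Ka; have [_ /(_ d Dd) Dd_] := D_graded.
  have := Dd_; apply: (@component_sum_ind _ _ _ _ [set e : endo A | K (e a)]).
    split=> [|c u v Ku Kv] /=; first by case: SK.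
    by case: SK => _; apply.
  move=> l {Dd_}d' [{}Dd dd] /=; case: grK => _ /(_ a Ka).
  apply: (@component_sum_ind _ _ _ _ [set a | K (d' a)]).
    split=> [|c u v Ku Kv] /=; first by rewrite linear0; case: SK.
    by rewrite linearP; case: SK => _; apply.
  move=> m b [Kb Ab] /=; rewrite /K /= -(color_bracket_der dd Ab).
  by apply: BI => //; apply: weyl_alg_der.
have [K0|KT] := simpleA K idK grK DK; [left|right].
  apply/seteqP; split=> [w /grI|_ ->]; last by case: SI.
  apply: component_sum_ind; first exact: subspace0.
  move=> l {}w [Iw [Ww dw]] /=; apply: contrapT => w0.
  have [_ [n ow]] : weyl_alg D w /\ exists n, color_diff_op n l w.
    apply: (homogeneous_mem (endo_deg_subspace A_graded)
      (endo_deg_independent A_graded) _ _ dw (weyl_alg_components Ww)).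
      by move=> j v [_ [n]] /color_diff_op_deg.
    by move=> j; split; [case: WS | exists 0].
  have [a a0] : exists2 a, a <> 0 & I (lmul_endo a).
    apply: (bracket_closed_lmul _ ow) => // j m v a _ Iv.
    have [Iav Iva] := idI _ _ (weyl_alg_lmul a) Iv.
    by apply: subspaceB => //; apply: subspaceZ.
  by move=> Ia; have : K a := Ia; rewrite K0.
apply/seteqP; split=> // w Ww.
have : K 1 by rewrite KT.
rewrite /K /= lmul_endo1 => I1.
by case: (idI w 1 Ww I1); rewrite mulr1.
Qed.

End WeylAlgebra.
End ColorDifferentialOperators.

Theorem theorem2p2 (F : fieldType) (charF : 2%N \notin [pchar F])
    (G : zmodType) (eps : G -> G -> F) (eps_bichar : skew_bicharacter eps)
    (A : algType F) (A_ : G -> set A) (A_graded : graded_algebra A_)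
    (A_comm : color_commutative eps A_)
    (D : set (endo A)) (D_der : D `<=` color_der eps A_)
    (D_graded : graded_subspace (color_der_deg eps A_) D)
    (D_neq0 : D <> [set 0])
    (D_comm : color_commutative_ops eps A_ D) :
  graded_simple (endo_deg A_) (weyl_alg D) <-> graded_D_simple A_ D.
Proof.
split; first exact: (graded_simple_weyl_D_simple eps_bichar).
exact: (D_simple_graded_simple_weyl eps_bichar).
Qed.
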